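(* Let $M$ be a compact, orientable smooth manifold of dimension $m\le n$ (possibly with boundary), let $\alpha\in\Omega^1_+(M,\mathbb R^n)$ and $\zeta,\eta\in T_\alpha\Omega^1_+(M,\mathbb R^n)$, and let $G$ be the generalized Ebin metric. (1) $G$ is invariant under pointwise left multiplication with $\operatorname{O}(n)$: for any smooth function $z:M\to\operatorname{O}(n)$, $$G_\alpha(\zeta,\eta)=G_{z\alpha}(z\zeta,z\eta).$$ (2) $G$ is invariant under the right action of the diffeomorphism group: for any $\varphi\in\operatorname{Diff}(M)$, $$G_\alpha(\zeta,\eta)=G_{\varphi^*\alpha}(\varphi^*\zeta,\varphi^*\eta).$$
   Context: $\Omega^1_+(M,\mathbb R^n)$ is the open subset of the Fréchet space $\Omega^1(M,\mathbb R^n)$ of smooth $\mathbb R^n$-valued one-forms consisting of those $\alpha$ for which $\alpha(x):T_xM\to\mathbb R^n$ is injective for all $x\in M$; $T_\alpha\Omega^1_+(M,\mathbb R^n)=\Omega^1(M,\mathbb R^n)$. In local coordinates (one-forms represented at $x$ by $n\times m$ matrices) $$G_\alpha(\zeta,\eta)=\int_M \operatorname{tr}\big(\zeta_x(\alpha_x^T\alpha_x)^{-1}\eta_x^T\big)\sqrt{\det(\alpha_x^T\alpha_x)}\,dx .$$ $\operatorname{Diff}(M)$ is the group of smooth diffeomorphisms of $M$, acting by pullback $\varphi^*\alpha(x)=\alpha(\varphi(x))\circ d\varphi(x)$. *)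

(* Defs.v *)
From HB Require Import structures.
From mathcomp Require Import all_boot all_order all_algebra.
From mathcomp Require Import all_classical all_reals all_analysis.

Set Implicit Arguments.
Unset Strict Implicit.
Unset Printing Implicit Defensive.

Import Order.TTheory GRing.Theory Num.Theory.
Import numFieldNormedType.Exports.

Local Open Scope classical_set_scope.
Local Open Scope ring_scope.

Section Euclidean.
Variables (R : realType) (m : nat).
Implicit Types (V S : set 'cV[R]_m).

Definition basis_vec (j : 'I_m) : 'cV[R]_m := delta_mx j ord0.

(* [0, +oo[ x R^(m-1); a point when m = 0 *)
Definition half_space : set 'cV[R]_m :=
  [set x | forall i : 'I_m, i = 0%N :> nat -> 0 <= x i ord0].

(* class C^k, on an open set V *)
Fixpoint class_C (k : nat) V (f : 'cV[R]_m -> R) : Prop :=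
  (forall x, V x -> {for x, continuous f}) /\
  if k is k'.+1 then
    forall j, (forall x, V x -> derivable f x (basis_vec j)) /\
              class_C k' V ('D_(basis_vec j) f)
  else True.

(* smoothness on an arbitrary set S, by local smooth extensions *)
Definition smooth_on S (f : 'cV[R]_m -> R) : Prop :=
  forall x, S x -> exists V g,
    [/\ open V, V x, forall k, class_C k V g & forall y, V y -> S y -> g y = f y].

Definition smooth_mx_on S p q (f : 'cV[R]_m -> 'M[R]_(p, q)) : Prop :=
  forall i j, smooth_on S (fun x => f x i j).

(* The increments h are restricted to those keeping x + h e_j in S, so that at
   a boundary point of the half-space the normal derivative is one-sided. *)
Definition jacobian_within S p (f : 'cV[R]_m -> 'cV[R]_p) (x : 'cV[R]_m) :
    'M[R]_(p, m) :=
  \matrix_(i, j) lim (h^-1 * (f (x + h *: basis_vec j) i ord0 - f x i ord0)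
    @[h --> within [set h | S (x + h *: basis_vec j)] (0 : R)^']).

End Euclidean.

Section SmoothTheory.
Variables (R : realType) (m : nat).
Implicit Types (V S : set 'cV[R]_m) (f g : 'cV[R]_m -> R).

Lemma class_C_sub k V V' f : V' `<=` V -> class_C k V f -> class_C k V' f.
Proof.
elim: k V V' f => [|k IH] V V' f sV /= [cf Df]; split=> //; do ?[by move=> x /sV /cf]; move=> j.
 have [df Cdf] := Df j.
by split=> [x /sV /df //|]; exact: IH sV Cdf.
Qed.

Lemma class_C_eq k V f g : open V -> (forall x, V x -> f x = g x) ->
  class_C k V f -> class_C k V g.
Proof.
move=> oV; elim: k f g => [|k IH] f g fg [cf Df].
all: have nfg x : V x -> \forall y \near x, f y = g y
  by move=> Vx; have := open_nbhs_nbhs (conj oV Vx); apply: filterS.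
all: have cg x : V x -> {for x, continuous g}
  by move=> Vx; rewrite /prop_for /continuous_at -(fg _ Vx);
     apply: cvg_trans (cf _ Vx); exact: near_eq_cvg (nfg _ Vx).
  by split.
split=> // j; have [df Cdf] := Df j; split.
  by move=> x Vx; apply: near_eq_derivable (df _ Vx); exact: nfg.
by apply: IH Cdf => x Vx; apply: near_eq_derive; exact: nfg.
Qed.

Lemma class_C_pred k V f : class_C k.+1 V f -> class_C k V f.
Proof.
elim: k f => [|k IH] f [cf Df]; split=> // j.
by have [df Cdf] := Df j; split=> //; exact: IH.
Qed.

Lemma class_CD k V f g : open V -> class_C k V f -> class_C k V g ->
  class_C k V (f + g).
Proof.
move=> oV; elim: k f g => [|k IH] f g [cf Df] [cg Dg].
all: have cfg x : V x -> {for x, continuous (f + g)}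
  by move=> Vx; exact: (cvgD (cf _ Vx) (cg _ Vx)).
  by split.
split=> // j; have [df Cdf] := Df j; have [dg Cdg] := Dg j; split.
  by move=> x Vx; apply: derivableD; [exact: df|exact: dg].
apply: class_C_eq (IH _ _ Cdf Cdg) => // x Vx.
by rewrite deriveD //; [exact: df|exact: dg].
Qed.

Lemma class_CM k V f g : open V -> class_C k V f -> class_C k V g ->
  class_C k V (f * g).
Proof.
move=> oV; elim: k f g => [|k IH] f g Cf Cg.
all: have cfg x : V x -> {for x, continuous (f * g)}
  by move=> Vx; exact: (cvgM (proj1 Cf _ Vx) (proj1 Cg _ Vx)).
  by split.
split=> // j; have [_ /(_ j)[df Cdf]] := Cf; have [_ /(_ j)[dg Cdg]] := Cg; split.
  by move=> x Vx; apply: derivableM; [exact: df|exact: dg].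
apply: (@class_C_eq _ _ (f * 'D_(basis_vec R j) g + g * 'D_(basis_vec R j) f)) => //.
  by move=> x Vx; rewrite deriveM //; [exact: df|exact: dg].
by apply: class_CD => //; apply: IH => //; exact: class_C_pred.
Qed.

Lemma class_C_cst k V (a : R) : class_C k V (fun=> a).
Proof.
have ca (a' : R) (x : 'cV[R]_m) : {for x, continuous (fun=> a')}.
  by apply: cst_continuous.
elim: k a => [|k IH] a; split=> // j.
split=> [x _|]; first exact: derivable_cst.
have -> : 'D_(basis_vec R j) (fun=> a) = (fun=> 0) :> ('cV[R]_m -> R).
  by apply/funext => x; rewrite derive_cst.
exact: IH.
Qed.

Lemma smooth_on_eq S f g : (forall x, S x -> f x = g x) ->
  smooth_on S f -> smooth_on S g.
Proof.
move=> fg sf x /sf[V [h [oV Vx Ch hf]]]; exists V, h; split=> // y Vy Sy.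
by rewrite hf // fg.
Qed.

Lemma smooth_on_cst S (a : R) : smooth_on S (fun=> a).
Proof.
move=> x Sx; exists setT, (fun=> a); split=> // [|k]; first exact: openT.
exact: class_C_cst.
Qed.

Lemma smooth_onD S f g : smooth_on S f -> smooth_on S g -> smooth_on S (f + g).
Proof.
move=> sf sg x Sx.
have [V [f' [oV Vx Cf ff]]] := sf x Sx; have [W [g' [oW Wx Cg gg]]] := sg x Sx.
exists (V `&` W), (f' + g'); split=> //; first exact: openI.
  move=> k; apply: class_CD; first exact: openI.
    exact: class_C_sub (Cf k).
  by apply: class_C_sub (Cg k).
by move=> y [Vy Wy] Sy; rewrite !fctE ff // gg.
Qed.

Lemma smooth_onM S f g : smooth_on S f -> smooth_on S g -> smooth_on S (f * g).
Proof.
move=> sf sg x Sx.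
have [V [f' [oV Vx Cf ff]]] := sf x Sx; have [W [g' [oW Wx Cg gg]]] := sg x Sx.
exists (V `&` W), (f' * g'); split=> //; first exact: openI.
  move=> k; apply: class_CM; first exact: openI.
    exact: class_C_sub (Cf k).
  by apply: class_C_sub (Cg k).
by move=> y [Vy Wy] Sy; rewrite !fctE ff // gg.
Qed.

Lemma smooth_mx_on_eq S p q (f g : 'cV[R]_m -> 'M[R]_(p, q)) :
  (forall x, S x -> f x = g x) -> smooth_mx_on S f -> smooth_mx_on S g.
Proof. by move=> fg sf i j; apply: smooth_on_eq (sf i j) => x /fg ->. Qed.

Lemma smooth_mx_onM S p q r (f : 'cV[R]_m -> 'M[R]_(p, q))
    (g : 'cV[R]_m -> 'M[R]_(q, r)) :
  smooth_mx_on S f -> smooth_mx_on S g -> smooth_mx_on S (fun x => f x *m g x).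
Proof.
move=> sf sg i j.
apply: (@smooth_on_eq _ (\sum_(k < q) ((fun x => f x i k) * (fun x => g x k j)))).
  by move=> x _; rewrite mxE fct_sumE.
elim/big_ind: _ => [|a b sa sb|k _]; first exact: smooth_on_cst.
  exact: smooth_onD.
exact: smooth_onM.
Qed.

End SmoothTheory.

(* integral over R^m, as an iterated Lebesgue integral *)
Fixpoint integral_Rn (R : realType) (m : nat) : ('cV[R]_m -> R) -> R :=
  if m is m'.+1 then
    fun f : 'cV[R]_(1 + m') -> R =>
      Rintegral (@lebesgue_measure R) setT
        (fun t => integral_Rn (fun x : 'cV[R]_m' => f (col_mx t%:M x)))
  else fun f => f 0.

Section Manifold.
Variables (R : realType) (m : nat).

(* coord is only relevant on dom, and param on the image of dom *)
Record chart (T : topologicalType) := Chart {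
  dom : set T;
  coord : T -> 'cV[R]_m;
  param : 'cV[R]_m -> T;
  dom_open : open dom;
  img_open : exists2 W, open W & coord @` dom = W `&` @half_space R m;
  coordK : forall p, dom p -> param (coord p) = p;
  coord_continuous : {within dom, continuous coord};
  param_continuous : {within coord @` dom, continuous param} }.

Definition img (T : topologicalType) (c : chart T) := coord c @` dom c.

Definition compatible (T : topologicalType) (c d : chart T) : Prop :=
  smooth_mx_on (coord c @` (dom c `&` dom d)) (coord d \o param c) /\
  smooth_mx_on (coord d @` (dom c `&` dom d)) (coord c \o param d).

(* smooth m-manifolds with (possibly empty) boundary; the atlas is maximal *)
Record manifold := Manifold {
  carrier :> topologicalType;
  manifold_hausdorff : hausdorff_space carrier;
  manifold_second_countable : @second_countable carrier;
  atlas : set (chart carrier);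
  atlas_cover : forall p, exists c, atlas c /\ dom c p;
  atlas_compatible : forall c d, atlas c -> atlas d -> compatible c d;
  atlas_maximal : forall c, (forall d, atlas d -> compatible c d) -> atlas c }.

Section OnManifold.
Variable M : manifold.
Implicit Types c d : chart M.

Definition chart_at (p : M) : chart M := projT1 (cid (atlas_cover p)).

Lemma chart_atP p : atlas (chart_at p) /\ dom (chart_at p) p.
Proof. by rewrite /chart_at; case: cid. Qed.

(* matrix of d_p f : T_p M -> T_(f p) M in the charts c and d *)
Definition diff_in (f : M -> M) c d (p : M) : 'M[R]_m :=
  jacobian_within (coord c @` (dom c `&` f @^-1` dom d))
    (coord d \o f \o param c) (coord c p).

(* An orientation is recorded by telling, for each chart c and point p of its
   domain, whether the coordinate frame of c at p is positive. *)
Definition orientable : Prop := exists o : chart M -> M -> bool,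
  (forall c p, atlas c -> dom c p -> \forall q \near p, o c q = o c p) /\
  (forall c d p, atlas c -> atlas d -> dom c p -> dom d p ->
     (o c p == o d p) = (0 < \det (diff_in id c d p))).

Definition smooth_fun (f : M -> R) : Prop :=
  forall c, atlas c -> smooth_on (img c) (f \o param c).

Definition smooth_mx p q (f : M -> 'M[R]_(p, q)) : Prop :=
  forall c, atlas c -> smooth_mx_on (img c) (f \o param c).

Definition smooth_map (f : M -> M) : Prop := continuous f /\
  forall c d, atlas c -> atlas d ->
    smooth_mx_on (coord c @` (dom c `&` f @^-1` dom d))
      (coord d \o f \o param c).

Record diffeo := Diffeo {
  diffeo_fun :> M -> M;
  diffeo_inv : M -> M;
  diffeoK : cancel diffeo_fun diffeo_inv;
  diffeoVK : cancel diffeo_inv diffeo_fun;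
  diffeo_smooth : smooth_map diffeo_fun;
  diffeo_inv_smooth : smooth_map diffeo_inv }.

(* smooth partitions of unity subordinate to finitely many charts *)
Definition partition_of_unity N (c : 'I_N -> chart M) (rho : 'I_N -> M -> R) :=
  (forall i, [/\ atlas (c i), smooth_fun (rho i), forall p, 0 <= rho i p
    & closure [set p | rho i p != 0] `<=` dom (c i)]) /\
  (forall p, \sum_(i < N) rho i p = 1).

(* A density is given by its coefficient f c in each chart c, where
   f c = |det (diff_in id c d)| * f d on the overlap with d. Its integral over
   a compact manifold is sum_i int_(img c_i) (rho_i f_(c_i)) o param c_i dx,
   which does not depend on the partition of unity (rho_i). *)
Definition integral_density (f : chart M -> M -> R) : R :=
  get [set v : R | exists N (c : 'I_N -> chart M) (rho : 'I_N -> M -> R),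
    partition_of_unity c rho /\
    v = \sum_(i < N) integral_Rn (fun x => \1_(img (c i)) x *
          (rho i (param (c i) x) * f (c i) (param (c i) x)))].

(* the chart c \o phi^-1 *)
Section Transport.
Variables (phi : diffeo) (c : chart M).
Let psi := diffeo_inv phi.

Let contV : continuous psi. Proof. by case: (diffeo_inv_smooth phi). Qed.
Let cont : continuous phi. Proof. by case: (diffeo_smooth phi). Qed.

Lemma transport_open : open (psi @^-1` dom c).
Proof. by apply: open_comp (dom_open c) => x _; exact: contV. Qed.

Lemma transport_img : (coord c \o psi) @` (psi @^-1` dom c) = img c.
Proof.
apply/seteqP; split=> _ [p cp <-]; first by exists (psi p).
by exists (phi p); rewrite /= /psi diffeoK.
Qed.

Lemma transport_img_open : exists2 W, open W &
  (coord c \o psi) @` (psi @^-1` dom c) = W `&` @half_space R m.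
Proof. by rewrite transport_img; exact: img_open. Qed.

Lemma transportK p : (psi @^-1` dom c) p ->
  (phi \o param c) ((coord c \o psi) p) = p.
Proof. by move=> cp /=; rewrite coordK // diffeoVK. Qed.

Lemma transport_coord_continuous :
  {within psi @^-1` dom c, continuous (coord c \o psi)}.
Proof.
have /subspace_continuousP cc := @coord_continuous M c.
apply/subspace_continuousP => p cp.
apply: cvg_comp (cc _ cp) => B; rewrite /= !nbhs_simpl /within /= => nB.
exact: contV nB.
Qed.

Lemma transport_param_continuous :
  {within (coord c \o psi) @` (psi @^-1` dom c), continuous (phi \o param c)}.
Proof.
rewrite transport_img; have /subspace_continuousP cc := @param_continuous M c.
apply/subspace_continuousP => x cx.
by apply: cvg_comp (cc _ cx) _; exact: cont.
Qed.

Definition transport : chart M :=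
  Chart transport_open transport_img_open transportK
    transport_coord_continuous transport_param_continuous.

Lemma img_transport : img transport = img c.
Proof. exact: transport_img. Qed.

Lemma atlas_transport : atlas c -> atlas transport.
Proof.
move=> Ac; apply: atlas_maximal => d Ad; split.
  have -> : coord transport @` (dom transport `&` dom d) =
            coord c @` (dom c `&` phi @^-1` dom d).
    apply/seteqP; split=> _ [p [cp dp] <-].
      by exists (psi p) => //; split=> //=; rewrite /psi diffeoVK.
    by exists (phi p); rewrite /= /psi diffeoK.
  by case: (diffeo_smooth phi) => _; apply.
have -> : coord d @` (dom transport `&` dom d) =
          coord d @` (dom d `&` psi @^-1` dom c) by rewrite setIC.
by case: (diffeo_inv_smooth phi) => _; apply.
Qed.

Lemma diff_in_transport (d : chart M) p : dom c p ->
  diff_in id transport d (phi p) = diff_in phi c d p.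
Proof.
move=> cp; rewrite /diff_in.
have -> : coord transport (phi p) = coord c p by rewrite /= /psi diffeoK.
have -> : coord transport @` (dom transport `&` id @^-1` dom d) =
          coord c @` (dom c `&` phi @^-1` dom d).
  apply/seteqP; split=> _ [q [cq dq] <-].
    by exists (psi q) => //; split=> //=; rewrite /psi diffeoVK.
  by exists (phi q); rewrite /= /psi diffeoK.
by [].
Qed.

Lemma diff_in_transportr (d : chart M) p : dom c p ->
  diff_in phi d transport p = diff_in id d c p.
Proof.
move=> cp; rewrite /diff_in.
have -> : coord transport \o phi \o param d = coord c \o id \o param d.
  by apply/funext => x; rewrite /= /psi diffeoK.
have -> // : phi @^-1` dom transport = dom c.
by apply/funext => q; rewrite /preimage /= /psi diffeoK.
Qed.

End Transport.

Section Forms.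
Variable n : nat.

(* R^n-valued one-forms: form c p is the n x m matrix of T_p M -> R^n in the
   coordinate basis of the chart c (irrelevant when p is outside dom c). *)
Definition is_form (a : chart M -> M -> 'M[R]_(n, m)) : Prop :=
  (forall c, atlas c -> smooth_mx_on (img c) (a c \o param c)) /\
  (forall c d p, atlas c -> atlas d -> dom c p -> dom d p ->
     a c p = a d p *m diff_in id c d p).

Record Omega1 := Form { form :> chart M -> M -> 'M[R]_(n, m);
                        formP : is_form form }.

Definition pointwise_injective (a : Omega1) : Prop :=
  forall c p, atlas c -> dom c p ->
    injective (fun v : 'cV[R]_m => a c p *m v).

Record Omega1_plus := FormPlus { form_plus :> Omega1;
                                 form_plusP : pointwise_injective form_plus }.

Definition ebin_metric (a : Omega1_plus) (zeta eta : Omega1) : R :=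
  integral_density (fun c p =>
    let g := (a c p)^T *m a c p in
    \tr (zeta c p *m invmx g *m (eta c p)^T) * Num.sqrt (\det g)).

Record smooth_On := SmoothOn {
  On_fun :> M -> 'M[R]_n;
  On_smooth : smooth_mx On_fun;
  On_orthogonal : forall p, (On_fun p)^T *m On_fun p = 1%:M }.

Section LeftMultiplication.
Variable z : smooth_On.

Definition lmul_fun (a : Omega1) (c : chart M) (p : M) : 'M[R]_(n, m) :=
  z p *m a c p.

Lemma lmul_is_form (a : Omega1) : is_form (lmul_fun a).
Proof.
have [sa ca] := formP a; split=> [c Ac|c d p Ac Ad cp dp].
  by apply: smooth_mx_onM; [exact: On_smooth|exact: sa].
by rewrite /lmul_fun (ca c d) // mulmxA.
Qed.

Definition lmul (a : Omega1) : Omega1 := Form (lmul_is_form a).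

Lemma lmul_injective (a : Omega1_plus) : pointwise_injective (lmul a).
Proof.
move=> c p Ac cp v w /= /(congr1 (mulmx (z p)^T)).
rewrite -!mulmxA !(mulmxA _ (z p)) On_orthogonal !mul1mx.
exact: form_plusP.
Qed.

Definition lmul_plus (a : Omega1_plus) : Omega1_plus :=
  FormPlus (@lmul_injective a).

End LeftMultiplication.

Section Pullback.
Variable phi : diffeo.

(* a (phi p) o d_p phi, computed in a chart at phi p *)
Definition pullback_fun (a : Omega1) (c : chart M) (p : M) : 'M[R]_(n, m) :=
  a (chart_at (phi p)) (phi p) *m diff_in phi c (chart_at (phi p)) p.

Lemma pullback_funE (a : Omega1) c d p : atlas c -> atlas d ->
  dom c p -> dom d (phi p) ->
  pullback_fun a c p = a d (phi p) *m diff_in phi c d p.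
Proof.
move=> Ac Ad cp dp; have [_ ca] := formP a.
have [Ae ep] := chart_atP (phi p).
have At := atlas_transport phi Ac.
have tp : dom (transport phi c) (phi p) by rewrite /= diffeoK.
by rewrite /pullback_fun -!diff_in_transport // -!(ca (transport phi c)).
Qed.

Lemma pullback_fun_transport (a : Omega1) c p : atlas c -> dom c p ->
  pullback_fun a c p = a (transport phi c) (phi p).
Proof.
move=> Ac cp; have [_ ca] := formP a.
have [Ae ep] := chart_atP (phi p).
rewrite /pullback_fun -diff_in_transport // -ca //; first exact: atlas_transport.
by rewrite /= diffeoK.
Qed.

Lemma pullback_is_form (a : Omega1) : is_form (pullback_fun a).
Proof.
have [sa ca] := formP a; split=> [c Ac|c d p Ac Ad cp dp].
  have := sa _ (atlas_transport phi Ac); rewrite img_transport.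
  apply: smooth_mx_on_eq => _ [p cp <-] /=.
  by rewrite coordK // pullback_fun_transport.
rewrite !pullback_fun_transport //.
rewrite (ca _ (transport phi d)) //=; try exact: atlas_transport; try by rewrite diffeoK.
by rewrite diff_in_transport // diff_in_transportr.
Qed.

Definition pullback (a : Omega1) : Omega1 := Form (pullback_is_form a).

Lemma pullback_injective (a : Omega1_plus) : pointwise_injective (pullback a).
Proof.
move=> c p Ac cp /=; rewrite pullback_fun_transport //.
by apply: form_plusP; [exact: atlas_transport|rewrite /= diffeoK].
Qed.

Definition pullback_plus (a : Omega1_plus) : Omega1_plus :=
  FormPlus (@pullback_injective a).

End Pullback.
End Forms.
End OnManifold.
End Manifold.

(* Main.v *)
Require Import Defs.
From HB Require Import structures.
From mathcomp Require Import all_boot all_order all_algebra.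
From mathcomp Require Import all_classical all_reals all_analysis.

(** Both invariances hold before any integration is carried out.

    Left multiplication: since [z^T z = 1], neither [alpha^T alpha] nor, by
    cyclicity of the trace, [tr (zeta g^-1 eta^T)] changes, so the two metric
    densities coincide at every point of every chart.

    Pullback: a diffeomorphism [phi] carries a chart [c] to the chart
    [c \o phi^-1], which has the same image in the half-space, and in these two
    charts [phi^* alpha] at [p] and [alpha] at [phi p] are the same matrix. The
    pulled-back metric density is thus the pullback of the metric density
    ([pullback_fun_transport]). A partition of unity [rho_i] subordinate to
    charts [c_i] is carried to the partition [rho_i \o phi^-1] subordinate to
    [c_i \o phi^-1] ([partition_of_unity_transport]), and the coordinate
    integrands attached to the two are equal as functions. The transport of
    charts is a bijection, with inverse the transport along [phi^-1], hence the
    two densities have exactly the same set of chartwise integrals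
    ([integral_density_pullback]), and the integral is a choice from this set. *)

Set Implicit Arguments.
Unset Strict Implicit.
Unset Printing Implicit Defensive.

Import GRing.Theory.

Local Open Scope classical_set_scope.
Local Open Scope ring_scope.

Lemma closure_preimage (T U : topologicalType) (f : T -> U) (A : set U) :
  continuous f -> closure (f @^-1` A) `<=` f @^-1` closure A.
Proof.
move=> cf; have /closure_id -> : closed (f @^-1` closure A).
  by apply: preimage_closed => [x _|]; [exact: cf|exact: closed_closure].
by apply: closureS => x; exact: (@subset_closure _ A (f x)).
Qed.

Section Diffeomorphisms.
Variables (R : realType) (m : nat) (M : manifold R m).
Implicit Types (phi : diffeo M) (c : chart R m M) (f : chart R m M -> M -> R).

Definition inverse_diffeo phi : diffeo M :=
  Diffeo (diffeoVK phi) (diffeoK phi) (diffeo_inv_smooth phi)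
    (diffeo_smooth phi).

Lemma chart_eq (c d : chart R m M) :
  dom c = dom d -> Defs.coord c = Defs.coord d -> param c = param d -> c = d.
Proof.
case: c d => [D x y o1 o2 o3 o4 o5] [D' x' y' p1 p2 p3 p4 p5] /= eD ex ey.
subst D' x' y'.
by rewrite (Prop_irrelevance o1 p1) (Prop_irrelevance o2 p2)
  (Prop_irrelevance o3 p3) (Prop_irrelevance o4 p4) (Prop_irrelevance o5 p5).
Qed.

Lemma transport_inverseK phi : cancel (transport (inverse_diffeo phi)) (transport phi).
Proof.
by move=> c; apply: chart_eq; apply/funext => x /=;
  rewrite /preimage /= ?diffeoVK.
Qed.

(** Read in the chart [c], the function [rho \o phi^-1] is [rho] read in the
    transport of [c] along [phi^-1]. *)
Lemma smooth_fun_transport phi (rho : M -> R) :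
  smooth_fun rho -> smooth_fun (rho \o diffeo_inv phi).
Proof.
move=> srho c Ac.
have := srho _ (atlas_transport (inverse_diffeo phi) Ac).
by rewrite img_transport.
Qed.

Lemma partition_of_unity_transport phi N (c : 'I_N -> chart R m M)
    (rho : 'I_N -> M -> R) : partition_of_unity c rho ->
  partition_of_unity (transport phi \o c) (fun i => rho i \o diffeo_inv phi).
Proof.
move=> [loc sum1]; split=> [i|p]; last exact: sum1.
have [Ac srho rho0 supp] := loc i; split=> [||p|].
- exact: atlas_transport.
- exact: smooth_fun_transport.
- exact: rho0.
have [contV _] := diffeo_inv_smooth phi.
by move=> p /(@closure_preimage _ _ _ [set q | rho i q != 0] contV) /supp.
Qed.

(** The set from which [integral_density f] is chosen, under a name so that two
    densities can be compared ahead of the choice. *)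
Definition chartwise_integrals f : set R :=
  [set v : R | exists N (c : 'I_N -> chart R m M) (rho : 'I_N -> M -> R),
    partition_of_unity c rho /\
    v = \sum_(i < N) integral_Rn (fun x => \1_(img (c i)) x *
          (rho i (param (c i) x) * f (c i) (param (c i) x)))].

(** Transporting charts and partition of unity along [phi] leaves each coordinate
    integrand unchanged, the hypothesis being that [f'] is the pullback
    [phi^* f]; the indicator disposes of the points outside the image of the
    chart, where [f'] and [f] are unrelated. *)
Lemma chartwise_integrals_sub phi f f' :
    (forall c p, atlas c -> dom c p -> f' c p = f (transport phi c) (phi p)) ->
  chartwise_integrals f' `<=` chartwise_integrals f.
Proof.
move=> f'E _ [N [c [rho [pou ->]]]].
exists N, (transport phi \o c), (fun i => rho i \o diffeo_inv phi).
split; first exact: partition_of_unity_transport.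
apply: eq_bigr => i _; congr integral_Rn; apply/funext => x.
rewrite [img ((transport phi \o c) i)]img_transport /= diffeoK !indicE.
have [|_] := boolP (x \in img (c i)); last by rewrite !mul0r.
rewrite inE => -[p cp <-]; rewrite coordK // f'E //.
by have [Ac _ _ _] := (proj1 pou) i.
Qed.

(** The inverse inclusion is the same one for [phi^-1], as [f] is in turn the
    pullback of [f'] along [phi^-1]. *)
Lemma integral_density_pullback phi f f' :
    (forall c p, atlas c -> dom c p -> f' c p = f (transport phi c) (phi p)) ->
  integral_density f' = integral_density f.
Proof.
move=> f'E.
suff E : chartwise_integrals f' = chartwise_integrals f.
  by rewrite /integral_density -!/(chartwise_integrals _) E.
apply/seteqP; split; first exact: chartwise_integrals_sub f'E.
apply: (@chartwise_integrals_sub (inverse_diffeo phi)) => c p Ac cp.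
rewrite f'E /=; last by rewrite diffeoVK.
  by rewrite diffeoVK transport_inverseK.
exact: atlas_transport.
Qed.

End Diffeomorphisms.

Definition ebin_density (R : realType) m n (a zeta eta : 'M[R]_(n, m)) : R :=
  \tr (zeta *m invmx (a^T *m a) *m eta^T) * Num.sqrt (\det (a^T *m a)).

Lemma ebin_density_lmul (R : realType) m n (z : 'M[R]_n)
    (a zeta eta : 'M[R]_(n, m)) : z^T *m z = 1%:M ->
  ebin_density (z *m a) (z *m zeta) (z *m eta) = ebin_density a zeta eta.
Proof.
move=> zz; rewrite /ebin_density.
have -> : (z *m a)^T *m (z *m a) = a^T *m a.
  by rewrite trmx_mul -mulmxA (mulmxA z^T) zz mul1mx.
by rewrite trmx_mul -!mulmxA mxtrace_mulC -!mulmxA zz mulmx1.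
Qed.

Theorem lemma4p1 (R : realType) (m n : nat) (M : manifold R m)
    (le_mn : (m <= n)%N)
    (compactM : compact [set: M]) (orientableM : orientable M)
    (alpha : Omega1_plus M n) (zeta eta : Omega1 M n) :
  (forall z : smooth_On M n,
     ebin_metric alpha zeta eta =
     ebin_metric (lmul_plus z alpha) (lmul z zeta) (lmul z eta)) /\
  (forall phi : diffeo M,
     ebin_metric alpha zeta eta =
     ebin_metric (pullback_plus phi alpha) (pullback phi zeta) (pullback phi eta)).
Proof.
split=> [z|phi].
  congr integral_density; apply/funext => c; apply/funext => p.
  by have := ebin_density_lmul (alpha c p) (zeta c p) (eta c p)
    (On_orthogonal z p).
symmetry; apply: (@integral_density_pullback _ _ _ phi) => c p Ac cp /=.
by rewrite !pullback_fun_transport.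
Qed.
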